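(* Let $2\le \ell<k$ be integers and let $F$ be a $(k-1)$-graph. Then $\pi_\ell(\mathcal S_F)=0$ if and only if $\pi_{\ell-1}(F)=0$, where $\mathcal S_F$ is the suspension of $F$.
   Context: A $k$-graph is a finite $k$-uniform hypergraph, with vertex set $V(F)$ and edge set $E(F)$. Suspension. Given a $(k-1)$-graph $F$, its suspension $\mathcal S_F$ is the $k$-graph obtained from $F$ by adding a new (apex) vertex $v\notin V(F)$ and replacing every edge $e\in E(F)$ by $e\cup\{v\}$. Degrees and degree Turán density. For a $k$-graph $H$ and $S\subseteq V(H)$ with $|S|<k$, the degree $d_H(S)$ is the number of edges of $H$ containing $S$; the minimum $\ell$-degree $\delta_\ell(H)$ is the minimum of $d_H(S)$ over all $\ell$-subsets $S$ of $V(H)$. $H$ is $F$-free if it contains no copy of $F$ as a (not necessarily induced) subhypergraph. For integers $1\le \ell<k$ and a $k$-graph $F$, $\mathrm{ex}_\ell(n,F)$ is the maximum of $\delta_\ell(H)$ over all $n$-vertex $F$-free $k$-graphs $H$, and $\pi_\ell(F)=\lim_{n\to\infty}\mathrm{ex}_\ell(n,F)/\binom{n-\ell}{k-\ell}$ (this limit is known to exist). For the $(k-1)$-graph $F$ in the claim, $\pi_{\ell-1}(F)$ is defined in the same way with uniformity $k-1$ in place of $k$ and $\ell-1$ in place of $\ell$. *)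

(* Defs.v *)
From mathcomp Require Import all_boot all_order all_algebra.
From mathcomp Require Import all_classical all_reals all_analysis.
Set Implicit Arguments.
Unset Strict Implicit.
Unset Printing Implicit Defensive.
Import Order.TTheory GRing.Theory Num.Theory.
Import numFieldNormedType.Exports.

Record hypergraph := Hypergraph {
  vertex : finType;
  edges : {set {set vertex}} }.

Definition kgraph (k : nat) (H : hypergraph) : bool :=
  [forall e in edges H, #|e| == k].

(* The apex is [None]; the original vertices are the [Some x]. *)
Definition suspension (F : hypergraph) : hypergraph :=
  @Hypergraph (option (vertex F))
    [set None |: (Some @: e) | e : {set vertex F} in edges F]%SET.

Definition degree (H : hypergraph) (S : {set vertex H}) : nat :=
  #|[set e in edges H | S \subset e]%SET|.

(* [#|edges H|] bounds every degree, so it does not affect the minimum as soon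
   as [H] has at least [l] vertices. *)
Definition min_degree (l : nat) (H : hypergraph) : nat :=
  \big[minn/#|edges H|]_(S : {set vertex H} | #|S| == l) degree S.

Definition has_copy (F H : hypergraph) : bool :=
  [exists f : {ffun vertex F -> vertex H},
    injectiveb f && [forall e in edges F, (f @: e)%SET \in edges H]].

(* Every n-vertex k-graph is, up to isomorphism, one on ['I_n]. The maximum is
   [0] if no n-vertex k-graph is F-free, which for large [n] happens only when
   [F] has no edge. *)
Definition ex_deg (k l n : nat) (F : hypergraph) : nat :=
  \max_(E : {set {set 'I_n}} |
        kgraph k (Hypergraph E) && ~~ has_copy F (Hypergraph E))
    min_degree l (Hypergraph E).

(* [is_degree_turan_density k l F p] says that [p] is the l-degree Turan density
   of the k-graph [F]. It is stated as a convergence because the operator [lim]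
   returns a default value on divergent sequences. *)
Definition is_degree_turan_density (R : realType) (k l : nat) (F : hypergraph)
    (p : R) : Prop :=
  ((fun n : nat => ((ex_deg k l n F)%:R / ('C(n - l, k - l))%:R)%R : R)
     @ \oo --> p)%classic.

(* Main.v *)
Require Import Defs.
From mathcomp Require Import all_boot all_order all_algebra.
From mathcomp Require Import all_classical all_reals all_analysis.
From mathcomp Require Import lra zify.
(* Names such as [subsetP], [ffunP] and [setIidPr] refer to finite types below. *)
From mathcomp Require Import fintype finfun finset.
Set Implicit Arguments.
Unset Strict Implicit.
Unset Printing Implicit Defensive.
Import Order.TTheory GRing.Theory Num.Theory.

(** One direction is the link argument: the link of a vertex in an
    [S_F]-free [k]-graph is an [F]-free [(k-1)]-graph on one vertex fewer, and
    its minimum [(l-1)]-degree is at least the minimum [l]-degree of the whole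
    graph. The two binomial normalisations agree, so the density of [S_F] is
    bounded by that of [F] ([ex_deg_suspension]).

    For the other direction write [d = l - 1] and [r = k - l], and suppose that
    there are [F]-free [(k-1)]-graphs [G], on arbitrarily large vertex sets [A], with
    minimum [d]-degree at least a fixed fraction of the maximum. Take a vertex
    set [V] much smaller than [A] and independent uniform labels
    [w (v, x)] in [A], one for every ordered pair of points of [V]; the row
    [x |-> w (v, x)] draws a private copy of [G] for the vertex [v]. Let [H]
    consist of the [k]-sets [e] such that, for every [v] in [e], the row of [v]
    maps [e :\ v] to an edge of [G]. As soon as all rows are injective, which is
    likely because [A] is large, every link of [H] embeds in [G], and [H] is
    [S_F]-free ([random_edges_suspension_free]).

    It remains to see that every [l]-set [S] lies in many edges. Given the labels
    on a [d]-subset of each row, a set [S :|: T] with [T] of size [r] is an edge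
    with probability at least a constant [c] ([mean_edge_ge]): each of its [k]
    vertices imposes one condition on its own row, which is an extension of a
    [d]-set to an edge of [G]. For disjoint sets [T] these events use disjoint
    sets of labels, so if [Y] counts those that occur among [q] disjoint sets,
    the mean of [2^-Y] is at most [(1 - c/2)^q] ([mean_missing_edges]).

    To pass from disjoint families to all [r]-sets, take [V] to be the product of
    ['I_r] and a cyclic group of order [Q]. The graphs of the functions from
    ['I_r] to the group are [Q^r] sets of size [r], and the translates of one
    graph are disjoint. As [S] and the graph range over polynomially many values
    while the failure probability is exponentially small, some labelling makes
    every translation class contribute linearly many edges for every [S]
    ([exists_good_labelling]). Summing over the classes gives each [S] a degree
    of order [Q^r] ([exists_dense_suspension_free]). *)

(** * Minimum degrees, extremal numbers and links *)

Section Transport.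
Local Open Scope set_scope.
Local Open Scope nat_scope.

Lemma min_degree_leP (l d : nat) (H : hypergraph) : l <= #|vertex H| ->
  reflect (forall S : {set vertex H}, #|S| = l -> d <= degree S)
          (d <= min_degree l H).
Proof.
move=> lV; apply: (iffP idP) => [dm S /eqP Sl|dS].
  apply: leq_trans dm _; rewrite /min_degree.
  elim: index_enum (mem_index_enum S) => // S' s IHs.
  rewrite inE big_cons => /predU1P[<-|/IHs le_s]; first by rewrite Sl geq_minl.
  by case: ifP => // _; apply: leq_trans (geq_minr _ _) le_s.
rewrite /min_degree; apply: (big_ind (fun x => d <= x)) => [|x y|S /eqP/dS //].
  have /card_gt0P[S]: 0 < #|[set S : {set vertex H} | #|S| == l]|.
    by rewrite card_draws bin_gt0.
  rewrite inE => /eqP /dS dS'; apply: leq_trans dS' _.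
  by apply: subset_leq_card; apply/subsetP => e; rewrite inE => /andP[].
by rewrite leq_min => -> ->.
Qed.

(** [ex_deg] only ranges over hypergraphs on ['I_n]; this transports an example
    living on any other vertex type. *)
Lemma leq_ex_deg (k l n d : nat) (F H : hypergraph) :
  #|vertex H| = n -> kgraph k H -> ~~ has_copy F H -> d <= min_degree l H ->
  l <= n -> d <= ex_deg k l n F.
Proof.
move=> Vn Hk HF dH ln; subst n.
pose f := @enum_rank (vertex H).
pose E := [set f @: e | e : {set vertex H} in edges H].
have finj : injective f by exact: enum_rank_inj.
have Ek : kgraph k (Hypergraph E).
  apply/forall_inP => /= _ /imsetP[e eH ->].
  by rewrite card_imset //; move/forall_inP: Hk; apply.
have EF : ~~ has_copy F (Hypergraph E).
  apply: contra HF => /existsP[g /andP[/injectiveP ginj /forall_inP gE]].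
  apply/existsP; exists [ffun x => enum_val (g x)]; apply/andP; split.
    by apply/injectiveP => x y; rewrite !ffunE => /enum_val_inj/ginj.
  apply/forall_inP => e /gE /imsetP[e' e'H ge].
  suff -> : [ffun x => enum_val (g x)] @: e = e' by [].
  transitivity (enum_val @: (g @: e)).
    rewrite -imset_comp; apply: eq_imset => x; rewrite ffunE //.
  rewrite ge -imset_comp -[RHS]imset_id; apply: eq_imset => x /=.
  by rewrite enum_rankK.
apply: leq_trans (leq_bigmax_cond E _); last first.
  by rewrite [kgraph _ _]Ek [has_copy _ _](negPf EF).
apply/min_degree_leP => /=; first by rewrite card_ord.
move=> S Sl.
have eS : S = f @: (enum_val @: S).
  rewrite -imset_comp -[LHS]imset_id; apply: eq_imset => x /=.
  by rewrite /f enum_valK.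
have Sl' : #|enum_val @: S| = l by rewrite card_imset //; exact: enum_val_inj.
move/min_degree_leP: dH => /(_ ln _ Sl') dS; apply: leq_trans dS _.
rewrite /degree -(card_imset _ (imset_inj finj)) /=.
apply: subset_leq_card; apply/subsetP => _ /imsetP[e + ->].
rewrite !inE => /andP[eH Se]; apply/andP; split; first exact: imset_f.
by rewrite eS imsetS.
Qed.

Lemma ex_deg_gt (k l n d : nat) (F : hypergraph) : d < ex_deg k l n F ->
  exists E : {set {set 'I_n}}, [/\ kgraph k (Hypergraph E),
    ~~ has_copy F (Hypergraph E) & min_degree l (Hypergraph E) = ex_deg k l n F].
Proof.
rewrite /ex_deg; case: (pickP (fun E : {set {set 'I_n}} =>
    kgraph k (Hypergraph E) && ~~ has_copy F (Hypergraph E))) => [E0 PE0 _|P0].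
  have [|E /andP[Ek EF] ->] := eq_bigmax_cond
     (fun E : {set {set 'I_n}} => min_degree l (Hypergraph E)) (A := [pred E : {set {set 'I_n}} |
       kgraph k (Hypergraph E) && ~~ has_copy F (Hypergraph E)]).
    by apply/card_gt0P; exists E0.
  by exists E.
by rewrite big_pred0.
Qed.

(** The witness is the link of a vertex [v]. A copy of [F] in it extends to a copy
    of the suspension by sending the apex to [v], and the degree of [S] in the
    link is the degree of [v |: S] in the original graph. *)
Lemma ex_deg_suspension (k l n : nat) (F : hypergraph) : 0 < l <= n ->
  ex_deg k l n (suspension F) <= ex_deg k.-1 l.-1 n.-1 F.
Proof.
move=> /andP[l0 ln].
have [->//|] := posnP (ex_deg k l n (suspension F)).
move=> /ex_deg_gt[E [Ek EF <-]].
have n0 : 0 < n by apply: leq_trans ln.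
pose v : 'I_n := Ordinal n0.
pose W := {x : 'I_n | x != v}.
pose L := @Hypergraph W [set e : {set W} | (v |: val @: e) \in E].
have vW (e : {set W}) : v \notin val @: e.
  by apply/imsetP => -[x _ vx]; case/eqP: (valP x).
have cW (e : {set W}) : #|v |: val @: e| = #|e|.+1.
  by rewrite cardsU1 vW card_imset //; exact: val_inj.
have W1 : #|{: W}| = n.-1.
  by rewrite card_sig; have := cardC1 v; rewrite card_ord => <-; apply: eq_card.
apply: (@leq_ex_deg _ _ _ _ _ L) => //.
- apply/forall_inP => e; rewrite inE => eE.
  by move/forall_inP: Ek => /(_ _ eE); rewrite cW => /eqP <-.
- apply: contra EF => /existsP[f /andP[/injectiveP finj /forall_inP fE]].
  apply/existsP; exists [ffun x => if x is Some y then val (f y) else v].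
  apply/andP; split.
    apply/injectiveP => -[x|] [y|]; rewrite !ffunE //.
    + by move=> /val_inj/finj ->.
    + by move=> e; case/eqP: (valP (f x)).
    + by move=> e; case/eqP: (valP (f y)).
  apply/forall_inP => _ /imsetP[e eF ->].
  have := fE _ eF; rewrite inE imsetU1 ffunE -!imset_comp.
  congr (v |: _ \in E); by apply: eq_imset => x /=; rewrite ffunE.
- apply/min_degree_leP => /=; first by rewrite W1 -!subn1 leq_sub2r.
  move=> S Sl.
  have Sl' : #|v |: val @: S| = l by rewrite cW Sl prednK.
  apply: leq_trans (_ : degree (H := Hypergraph E) (v |: val @: S) <= _).
    have lV : l <= #|vertex (Hypergraph E)| by rewrite card_ord.
    exact: (elimT (min_degree_leP _ lV) (leqnn _) _ Sl').
  pose g (e : {set W}) : {set 'I_n} := v |: val @: e.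
  have ginj : injective g.
    move=> e e' /(congr1 (fun A => A :\ v)); rewrite !setU1K //.
    exact/imset_inj/val_inj.
  rewrite /degree -(card_imset _ ginj).
  apply: subset_leq_card; apply/subsetP => e.
  rewrite inE => /andP[eE /subsetP Se].
  have ge : g [set x : W | val x \in e] = e.
    apply/setP => x; rewrite !inE; case: eqP => [->|/eqP xv] /=.
      by rewrite Se // setU11.
    apply/imsetP/idP => [[y]|xe]; first by rewrite inE => ? ->.
    by exists (Sub x xv); rewrite ?inE ?SubK.
  rewrite -ge; apply: imset_f; rewrite inE.
  have -> : [set x | val x \in e] \in edges L by rewrite inE -/(g _) ge.
  apply/subsetP => x xS; rewrite inE; apply: Se.
  by rewrite inE imset_f // orbT.
- by rewrite -!subn1 leq_sub2r.
Qed.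
End Transport.

(** * Averages over independent labels *)

Lemma sum_swap (R : nmodType) (T : finType) (s : T -> T -> T) (h : T -> T -> R) :
  (forall x y, s (s x y) (s y x) = x) ->
  (\sum_x \sum_y h x y = \sum_x \sum_y h (s x y) (s y x))%R.
Proof.
move=> sK; rewrite !pair_bigA (reindex_inj (h := fun p => (s p.1 p.2, s p.2 p.1))) //.
by apply: (inv_inj (f := fun p => (s p.1 p.2, s p.2 p.1))) => -[x y] /=; rewrite !sK.
Qed.

Section Resampling.
Local Open Scope set_scope.
Local Open Scope ring_scope.
Variables (R : realFieldType) (I A : finType) (a0 : A).
Notation Omega := {ffun I -> A}.

Definition mean (f : Omega -> R) : R := (\sum_w f w) / #|{: Omega}|%:R.

Definition resample (C : {set I}) (w w' : Omega) : Omega :=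
  [ffun i => if i \in C then w' i else w i].

Definition ignores (C : {set I}) (f : Omega -> R) :=
  forall w w', f (resample C w w') = f w.

Lemma card_Omega_gt0 : 0 < #|{: Omega}|%:R :> R.
Proof.
by rewrite ltr0n; apply/card_gt0P; exists [ffun => a0].
Qed.

Lemma mean_le f g : (forall w, f w <= g w) -> mean f <= mean g.
Proof.
move=> fg; rewrite ler_wpM2r ?invr_ge0 ?(ltW card_Omega_gt0) //.
exact: ler_sum.
Qed.

Lemma mean_cst c : mean (fun=> c) = c.
Proof.
by rewrite /mean sumr_const -[_ *+ _]mulr_natr mulfK // gt_eqF ?card_Omega_gt0.
Qed.

Lemma eq_mean f g : f =1 g -> mean f = mean g.
Proof. by move=> fg; rewrite /mean (eq_bigr g). Qed.

Lemma meanD f g : mean (fun w => f w + g w) = mean f + mean g.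
Proof. by rewrite /mean big_split mulrDl. Qed.

Lemma meanZ c f : mean (fun w => c * f w) = c * mean f.
Proof. by rewrite /mean -mulr_sumr mulrA. Qed.

Lemma mean_sum (J : Type) (r : seq J) (P : pred J) (f : J -> Omega -> R) :
  mean (fun w => \sum_(j <- r | P j) f j w) = \sum_(j <- r | P j) mean (f j).
Proof. by rewrite /mean exchange_big mulr_suml. Qed.

Lemma mean_lt_ex f c : mean f < c -> exists w, f w < c.
Proof.
move=> fc; apply/existsP; apply: contraTT fc => /existsPn H.
rewrite -leNgt -[leLHS]mean_cst; apply: mean_le => w.
by rewrite leNgt.
Qed.

(** Fubini for independent coordinates: exchanging the [C]-coordinates of two
    independent samples is a measure-preserving involution, and it is invisible
    to [g]. *)
Lemma mean_resample C f g : ignores C g ->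
  mean (fun w => g w * f w) =
  mean (fun w => g w * mean (fun w' => f (resample C w w'))).
Proof.
move=> gC; rewrite -[in LHS](mean_cst (mean _)) /mean; congr (_ / _).
transitivity (\sum_(w : Omega) \sum_(w' : Omega) g w * f w / #|{: Omega}|%:R).
  rewrite sumr_const -[LHS]mulr_natr divfK ?gt_eqF ?card_Omega_gt0 //.
  apply: eq_bigr => w _.
  by rewrite sumr_const -[_ *+ _]mulr_natr divfK ?gt_eqF ?card_Omega_gt0.
transitivity (\sum_(w : Omega) \sum_(w' : Omega) g w * f (resample C w w') / #|{: Omega}|%:R).
  rewrite (sum_swap (s := resample C)); last first.
    move=> w w'; apply/ffunP => i; rewrite !ffunE.
    by case: (i \in C).
  by apply: eq_bigr => w _; apply: eq_bigr => w' _; rewrite gC.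
by apply: eq_bigr => w _; rewrite -mulr_suml -mulr_sumr mulrA.
Qed.

(** Conditional independence in the form used below, both for upper and for lower
    bounds. The factor [f j] may read its own block [C j] and coordinates outside
    all blocks; [g] reads only the latter and can be the indicator of the event on
    which the bounds for a single factor hold. *)
Lemma mean_prod_bounds (J : eqType) (s : seq J) (C : J -> {set I})
    (f : J -> Omega -> R) (g : Omega -> R) (a b : R) :
  uniq s -> 0 <= a ->
  (forall w, 0 <= g w) ->
  {in s, forall j, ignores (C j) g} ->
  {in s, forall j w, 0 <= f j w} ->
  {in s &, forall i j, i != j -> ignores (C i) (f j)} ->
  {in s, forall j w, 0 < g w ->
     a <= mean (fun w' => f j (resample (C j) w w')) <= b} ->
  a ^+ size s * mean g <= mean (fun w => g w * \prod_(j <- s) f j w)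
    <= b ^+ size s * mean g.
Proof.
move=> + a0'; elim: s => [_ _ _ _ _ _|j s IH /= /andP[js us] g0 gC f0 fC fab].
  rewrite (eq_mean (g := g)) => [|w]; last by rewrite big_nil mulr1.
  by rewrite expr0 mul1r lexx.
have js' : j \in j :: s by exact: mem_head.
have {IH} := IH us g0 (sub_in1 _ gC) (sub_in1 _ f0) (sub_in2 _ fC) (sub_in1 _ fab).
have sub i : i \in s -> i \in j :: s by rewrite inE orbC => ->.
move=> /(_ sub sub sub sub) /andP[lo hi].
pose g' w := g w * \prod_(i <- s) f i w.
have g'0 w : 0 <= g' w.
  rewrite mulr_ge0 // big_seq; apply: prodr_ge0 => i si; exact: f0 (sub _ si) w.
have g'C : ignores (C j) g'.
  move=> w w'; rewrite /g' gC //; congr (_ * _).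
  apply: eq_big_seq => i si; apply: fC => //; first exact: sub.
  by apply/eqP => ji; rewrite ji si in js.
have -> : mean (fun w => g w * \prod_(i <- (j :: s)) f i w) =
    mean (fun w => g' w * f j w).
  by apply: eq_mean => w; rewrite big_cons /g' mulrAC mulrA.
rewrite (mean_resample _ g'C).
have key w : a * g' w <= g' w * mean (fun w' => f j (resample (C j) w w')) <= b * g' w.
  have := g0 w; rewrite le_eqVlt => /predU1P[gw0|gw].
    by rewrite /g' -gw0 !mul0r !mulr0 lexx.
  by have /andP[? ?] := fab _ js' _ gw; rewrite ![_ * g' w]mulrC !ler_wpM2l.
apply/andP; split.
  rewrite exprS -mulrA; apply: le_trans (ler_wpM2l a0' lo) _.
  by rewrite -meanZ; apply: mean_le => w; have /andP[] := key w.
(* If [b] is negative, the bounds force [g] to vanish. *)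
have [b0|b0] := leP 0 b.
  apply: le_trans (_ : b * mean g' <= _).
    by rewrite -meanZ; apply: mean_le => w; have /andP[] := key w.
  by rewrite exprS -mulrA ler_wpM2l.
have g0' w : g w = 0.
  have := g0 w; rewrite le_eqVlt => /predU1P[//|gw].
  have /andP[h1 h2] := fab _ js' _ gw.
  by have := lt_le_trans b0 (le_trans a0' (le_trans h1 h2)); rewrite ltxx.
rewrite (eq_mean (g := fun=> 0)) ?mean_cst; last by move=> w; rewrite /g' g0' !mul0r.
by rewrite (eq_mean (f := g) (g := fun=> 0)) ?mean_cst ?mulr0.
Qed.

(** The indicator is a product over the coordinates, and the sum over all functions
    of such a product is the product of the sums. *)
Lemma mean_cylinder (K : {set I}) (y : I -> A) :
  mean (fun w => [forall i in K, w i == y i]%:R) = #|A|%:R ^- #|K|.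
Proof.
have A0 : #|A|%:R != 0 :> R by rewrite pnatr_eq0 -lt0n; apply/card_gt0P; exists a0.
have -> : mean (fun w => [forall i in K, w i == y i]%:R) =
  (\sum_(w : Omega) \prod_i (if i \in K then (w i == y i)%:R else 1)) / #|{: Omega}|%:R.
  congr (_ / _); apply: eq_bigr => w _; rewrite -big_mkcond /=.
  case: forall_inP => [Kw|/forall_inP].
    by rewrite big1 // => i /Kw ->.
  by move=> /forall_inPn[i iK /negPf wi]; rewrite (bigD1 i) //= wi mul0r.
rewrite -(bigA_distr_bigA (fun i b => if i \in K then (b == y i)%:R else 1)) /=.
rewrite card_ffun natrX.
rewrite (eq_bigr (fun i => if i \in K then 1 else #|A|%:R)); last first.
  move=> i _; case: ifP => _; last by rewrite sumr_const.
  by rewrite (bigD1 (y i)) //= eqxx big1 ?addr0 // => b /negPf ->.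
rewrite (bigID (mem K)) /= big1 ?mul1r; last by move=> i ->.
rewrite (eq_bigr (fun=> #|A|%:R)); last by move=> i /negPf ->.
rewrite prodr_const -(cardC (mem K)) exprD.
by rewrite invfM mulrCA divff ?mulr1 // expf_neq0.
Qed.
End Resampling.

(** * The random hypergraph *)

Lemma prodr_bool (R : comNzRingType) (T : finType) (B : {set T}) (b : pred T) :
  (\prod_(x <- enum B) (b x)%:R = [forall x in B, b x]%:R :> R)%R.
Proof.
rewrite big_enum /=; case: forall_inP => [Bb|/forall_inP].
  by rewrite big1 // => x /Bb ->.
by move=> /forall_inPn[x xB /negPf bx]; rewrite (bigD1 x) //= bx mul0r.
Qed.

Section RandomHypergraph.
Local Open Scope set_scope.
Local Open Scope ring_scope.
Variables (R : realFieldType) (A V : finType) (a0 : A) (G : {set {set A}}).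
Notation Omega := {ffun V * V -> A}.
Notation mean := (@mean R (V * V)%type A).

Definition row (w : Omega) (v : V) : V -> A := fun x => w (v, x).

(** The largest [k]-graph in which the row of [v] maps the link of [v] into [G]. *)
Definition random_edges (k : nat) (w : Omega) : {set {set V}} :=
  [set e : {set V} | (#|e| == k) && [forall v in e, row w v @: (e :\ v) \in G]].

Lemma random_edges_kgraph k w : kgraph k (Hypergraph (random_edges k w)).
Proof. by apply/forall_inP => e; rewrite inE => /andP[]. Qed.

(** If [f] embeds the suspension, the row of the image of the apex carries the rest
    of the copy into [G]. *)
Lemma random_edges_suspension_free (F : hypergraph) k (w : Omega) :
  (forall v, injective (row w v)) -> ~~ has_copy F (Hypergraph G) ->
  ~~ has_copy (suspension F) (Hypergraph (random_edges k w)).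
Proof.
move=> winj; apply: contra => /existsP[/= f /andP[/injectiveP finj /forall_inP fE]].
apply/existsP; exists [ffun x => row w (f None) (f (Some x))]; apply/andP; split.
  by apply/injectiveP => x y; rewrite !ffunE => /winj/finj[].
apply/forall_inP => e eF.
have /fE : None |: Some @: e \in edges (suspension F) by exact: imset_f.
rewrite inE => /andP[_ /forall_inP /(_ (f None))].
rewrite imsetU1 setU11 setU1K => [/(_ isT)|]; last first.
  by apply/imsetP => -[y /imsetP[x _ ->] /finj].
by rewrite -!imset_comp; congr (_ \in G); apply: eq_imset => x; rewrite ffunE.
Qed.

(** Each edge [e] of [G] through [B] contributes the event that the row maps [T] onto
    [e :\: B] by one prescribed bijection, of probability [#|A|^-r]. These events
    are disjoint for distinct [e]. *)
Lemma mean_ge_subset (d r delta : nat) (v : V) (B : {set A}) (T : {set V}) :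
  (forall e, e \in G -> #|e| = (d + r)%N) ->
  (forall B : {set A}, #|B| = d -> (delta <= #|[set e in G | B \subset e]|)%N) ->
  #|B| = d -> #|T| = r ->
  delta%:R / #|A|%:R ^+ r <= mean (fun w => (B :|: row w v @: T \in G)%:R).
Proof.
move=> Gk Gd Bd Tr.
(* The prescribed bijection matches the enumerations of [T] and [e :\: B]. *)
pose y (e : {set A}) (i : V * V) : A := nth a0 (enum (e :\: B)) (index i.2 (enum T)).
pose KT := setX [set v] T.
have cK : #|KT| = r by rewrite cardsX cards1 mul1n.
pose N := [set e in G | B \subset e].
have yT e : e \in N -> [set y e (v, x) | x in T] = e :\: B.
  rewrite inE => /andP[eG Be].
  have cU : size (enum (e :\: B)) = r.
    by rewrite -cardE cardsD (setIidPr Be) Bd Gk // addKn.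
  apply/setP => b; apply/imsetP/idP => [[x xT ->]|bU].
    by rewrite -mem_enum mem_nth // cU -Tr cardE index_mem mem_enum.
  have b_lt : (index b (enum (e :\: B)) < size (enum T))%N.
    by rewrite -cardE Tr -cU index_mem mem_enum.
  have /card_gt0P[x0 x0T] : (0 < #|T|)%N.
    by rewrite cardE; apply: leq_ltn_trans b_lt.
  exists (nth x0 (enum T) (index b (enum (e :\: B)))).
    by rewrite -mem_enum mem_nth.
  by rewrite /y index_uniq ?enum_uniq // nth_index // mem_enum.
pose X e (w : Omega) : R := [forall i in KT, w i == y e i]%:R.
have Xe e (w : Omega) : e \in N -> [forall i in KT, w i == y e i] -> B :|: row w v @: T = e.
  move=> eN /forall_inP h; have := eN; rewrite inE => /andP[_ Be].
  transitivity (B :|: (e :\: B)); last by rewrite setDE setUIr setUCr setIT (setUidPr Be).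
  congr (_ :|: _); rewrite -yT //; apply: eq_in_imset => x xT; apply/eqP/h.
  by rewrite inE /= !inE eqxx.
apply: le_trans (_ : mean (fun w => \sum_(e in N) X e w) <= _).
  rewrite mean_sum (eq_bigr (fun=> #|A|%:R ^- r)); last first.
    by move=> e _; rewrite /X mean_cylinder // cK.
  rewrite sumr_const -[leRHS]mulr_natl ler_wpM2r ?invr_ge0 ?exprn_ge0 //.
  by rewrite ler_nat Gd.
apply: mean_le => // w.
case: (pickP (fun e => (e \in N) && [forall i in KT, w i == y e i])) => [e|X0].
  case/andP=> eN Xew; rewrite (Xe e) //; have := eN; rewrite inE => /andP[-> _].
  rewrite (bigD1 e) //= big1 ?addr0 ?lern1 ?leq_b1 // => e' /andP[e'N e'e].
  rewrite /X; case h: [forall i in _, _] => //.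
  by move: e'e; rewrite -(Xe e' w) // (Xe e) ?eqxx.
by rewrite big1 // => e eN; rewrite /X; have := X0 e; rewrite eN /= => ->.
Qed.

Variables (d r delta : nat).
Hypothesis Gk : (forall e, e \in G -> #|e| = (d + r)%N).
Hypothesis Gd :
  forall B : {set A}, #|B| = d -> (delta <= #|[set e in G | B \subset e]|)%N.
Variables (S : {set V}) (s0 : V).
Hypotheses (cS : #|S| = d.+1) (s0S : s0 \in S).

(** The part of the row of [v] that is revealed beforehand. It always has [d]
    elements: with [S :\ v] this is automatic for [v] in [S], and for the other
    vertices the point [s0] is left out. Thus, in any edge containing [S], every
    vertex sees the same problem of extending a [d]-set to an edge of [G]. *)
Definition kept (v : V) : {set V} := if v \in S then S :\ v else S :\ s0.

(** The labels, other than the revealed ones, that decide whether [S :|: T] is an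
    edge. For disjoint sets [T] these blocks are disjoint. *)
Definition redrawn (T : {set V}) : {set V * V} :=
  [set i : V * V | [&& i.1 \in S :|: T, i.2 \in S :|: T, i.2 != i.1
                     & i.2 \notin kept i.1]].

Definition kept_injective (w : Omega) : bool :=
  [forall v, #|row w v @: kept v| == d].

Notation p := (delta%:R / #|A|%:R ^+ r : R).

Lemma kept_subset v : kept v \subset S.
Proof. by rewrite /kept; case: ifP => _; exact: subsetDl. Qed.

Lemma card_kept v : #|kept v| = d.
Proof.
rewrite /kept; case: ifP => vS; apply: succn_inj; rewrite -cS.
  by rewrite [in RHS](cardsD1 v) vS.
by rewrite [in RHS](cardsD1 s0) s0S.
Qed.

Lemma notin_kept v : v \notin kept v.
Proof. by rewrite /kept; case: ifP => vS; rewrite !inE ?vS ?eqxx ?andbF. Qed.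

(** The [d + r + 1] conditions for [S :|: T] to be an edge concern different rows, so
    the bound of [mean_ge_subset] is multiplied over them. *)
Lemma mean_edge_ge (T : {set V}) (w : Omega) :
  #|T| = r -> [disjoint S & T] -> kept_injective w ->
  p ^+ (d + r).+1 <=
  mean (fun w' =>
    (S :|: T \in random_edges (d + r).+1 (resample (redrawn T) w w'))%:R).
Proof.
move=> cT ST /forallP winj; set C := redrawn T.
have cST : #|S :|: T| = (d + r).+1.
  by rewrite cardsU disjoint_setI0 // cards0 subn0 cS cT.
pose f v (w' : Omega) : R := (row (resample C w w') v @: ((S :|: T) :\ v) \in G)%:R.
pose K v := [set i : V * V | i.1 == v].
have p0 : 0 <= p by rewrite divr_ge0 ?exprn_ge0.
have fK : {in enum (S :|: T) &, forall u v, u != v -> ignores (K u) (f v)}.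
  move=> u v _ _ uv w' w''; rewrite /f; congr (_ \in G)%:R.
  apply: eq_imset => x; rewrite /row !ffunE; case: ifP => // _.
  by rewrite inE /= eq_sym (negPf uv).
have fp : {in enum (S :|: T), forall v w', 0 < 1 :> R ->
    p <= mean (fun w'' => f v (resample (K v) w' w'')) <= 1}.
  move=> v; rewrite mem_enum => vST w' _; apply/andP; split; last first.
    rewrite -[leRHS](@mean_cst R (V * V)%type A a0); apply: mean_le => // w''.
    by rewrite /f lern1 leq_b1.
  pose Tv := (S :|: T) :\ v :\: kept v.
  have kv : kept v \subset (S :|: T) :\ v.
    rewrite subsetD1 notin_kept andbT.
    exact: subset_trans (kept_subset v) (subsetUl _ _).
  have cTv : #|Tv| = r.
    rewrite cardsD (setIidPr kv) card_kept.
    have := cardsD1 v (S :|: T); rewrite vST cST; lia.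
  apply: le_trans (mean_ge_subset v Gk Gd (eqP (winj v)) cTv) _.
  apply: mean_le => // w''; rewrite /f.
  suff -> : row (resample C w (resample (K v) w' w'')) v @: ((S :|: T) :\ v) =
      row w v @: kept v :|: row w'' v @: Tv by [].
  have -> : (S :|: T) :\ v = kept v :|: Tv.
    by rewrite -[LHS](setID _ (kept v)) (setIidPr kv).
  rewrite imsetU; congr (_ :|: _); apply: eq_in_imset => x.
    by move=> xv; rewrite /row !ffunE !inE /= xv !andbF.
  rewrite !inE => /and3P[xv xnv xST].
  by rewrite /row !ffunE !inE /= xST xnv xv eqxx; rewrite inE in vST; rewrite vST.
have /andP[lo _] := mean_prod_bounds a0 (enum_uniq _) p0 (g := fun=> 1)
  (fun=> ler01) (fun _ _ _ _ => erefl) (fun _ _ _ => ler0n _ _) fK fp.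
move: lo; rewrite -cardE cST mean_cst // mulr1 => /le_trans; apply.
apply: mean_le => // w'; rewrite mul1r (prodr_bool _ (S :|: T)
  (fun v => row (resample C w w') v @: ((S :|: T) :\ v) \in G)).
by rewrite inE cST eqxx.
Qed.

(** The product is [2^-Y], where [Y] counts the sets [S :|: T j] that are edges, so
    this is an exponential moment bound: it makes few edges over [S] exponentially
    unlikely in the number of disjoint sets [T j]. Injectivity of the revealed
    labels is what [mean_edge_ge] needs for every single factor. *)
Lemma mean_missing_edges (J : eqType) (js : seq J) (T : J -> {set V}) :
  p <= 1 -> uniq js -> {in js, forall j, #|T j| = r} ->
  {in js, forall j, [disjoint S & T j]} ->
  {in js &, forall i j, i != j -> [disjoint T i & T j]} ->
  mean (fun w => (kept_injective w)%:R * \prod_(j <- js)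
     (1 - (S :|: T j \in random_edges (d + r).+1 w)%:R / 2)) <=
  (1 - p ^+ (d + r).+1 / 2) ^+ size js.
Proof.
move=> p1 ujs cT ST TT.
have p0 : 0 <= p by rewrite divr_ge0 ?exprn_ge0.
pose f j (w : Omega) : R := 1 - (S :|: T j \in random_edges (d + r).+1 w)%:R / 2.
have fE w j : 0 <= f j w <= 1.
  by rewrite /f; case: (_ \in _); rewrite ?mulr1n ?mulr0n; apply/andP; split; lra.
have gC : {in js, forall j, ignores (redrawn (T j)) (fun w => (kept_injective w)%:R : R)}.
  move=> j _ w w'; congr (nat_of_bool _)%:R; apply: eq_forallb => v.
  congr (#|pred_of_set _| == d); apply: eq_in_imset => x xv.
  by rewrite /row ffunE inE /= xv !andbF.
have fC : {in js &, forall i j, i != j -> ignores (redrawn (T i)) (f j)}.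
  move=> i j ijs jjs ij w w'; rewrite /f !inE; congr (1 - (nat_of_bool (_ && _))%:R / 2).
  apply: eq_forallb_in => v vSj; congr (_ \in G); apply: eq_in_imset => x.
  rewrite in_setD1 => /andP[xv xSj]; rewrite /row ffunE inE /=.
  case: ifP => // /and4P[vSi xSi _ xk].
  have inS z : z \in S :|: T j -> z \in S :|: T i -> z \in S.
    rewrite !inE; case: (z \in S) => //= zj zi.
    by have /disjoint_setI0/setP/(_ z) := TT _ _ ijs jjs ij; rewrite !inE zi zj.
  by move: xk; rewrite /kept inS // !inE xv inS.
have fab : {in js, forall j w, 0 < (kept_injective w)%:R :> R ->
    0 <= mean (fun w' => f j (resample (redrawn (T j)) w w'))
      <= 1 - p ^+ (d + r).+1 / 2}.
  move=> j jjs w; rewrite ltr0n lt0b => kw; apply/andP; split.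
    rewrite -(@mean_cst R (V * V)%type A a0 0); apply: mean_le => // w'.
    by have /andP[] := fE (resample (redrawn (T j)) w w') j.
  have := mean_edge_ge (cT _ jjs) (ST _ jjs) kw.
  rewrite /f; under [X in _ -> X <= _]eq_mean do rewrite mulrC -mulNr.
  rewrite meanD meanZ mean_cst //; lra.
have /andP[_ hi] := mean_prod_bounds a0 ujs (lexx 0) (fun w => ler0n R (kept_injective w))
  gC (fun j _ w => proj1 (andP (fE w j))) fC fab.
apply: le_trans hi _; rewrite -[leRHS]mulr1 ler_wpM2l //.
  by rewrite exprn_ge0 //; have := exprn_ile1 (d + r).+1 p0 p1; lra.
rewrite -[leRHS](@mean_cst R (V * V)%type A a0); apply: mean_le => // w.
by rewrite lern1 leq_b1.
Qed.
End RandomHypergraph.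

(** * Translates of graphs and the choice of a labelling *)

Lemma leq_bin_expn n m : ('C(n, m) <= n ^ m)%N.
Proof.
apply: leq_trans (leq_pmulr _ (fact_gt0 m)) _; rewrite bin_ffact.
by elim: m => // m IH; rewrite ffactnSr expnSr leq_mul // leq_subr.
Qed.

Section DenseSuspensionFree.
Local Open Scope set_scope.
Local Open Scope ring_scope.

(** A union bound over the vertex [v] and the pair of points where its row takes
    the same value. *)
Lemma mean_not_injective (R : realFieldType) (A V : finType) (a0 : A) :
  mean (fun w : {ffun V * V -> A} => [exists v, ~~ injectiveb (row w v)]%:R) <=
  (#|V| ^ 3)%:R / #|A|%:R :> R.
Proof.
have collide v x y : x != y ->
    mean (fun w : {ffun V * V -> A} => (w (v, x) == w (v, y))%:R) = #|A|%:R^-1 :> R.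
  move=> xy; pose f (w : {ffun V * V -> A}) : R := (w (v, x) == w (v, y))%:R.
  rewrite (eq_mean (g := fun w => 1 * f w)) => [|w]; last by rewrite mul1r.
  rewrite (@mean_resample _ _ _ a0 [set (v, x)]) // -[RHS](@mean_cst R (V * V)%type A a0).
  apply: eq_mean => w; rewrite mul1r.
  rewrite -[RHS](_ : #|A|%:R ^- #|[set (v, x)]| = _); last by rewrite cards1 expr1.
  rewrite -(@mean_cylinder R _ A a0 [set (v, x)] (fun=> w (v, y))).
  apply: eq_mean => w'; rewrite /f !ffunE !inE eqxx.
  have -> : ((v, y) == (v, x)) = false by rewrite xpair_eqE eq_sym (negPf xy) andbF.
  congr (nat_of_bool _)%:R; apply/idP/forall_inP => [h i|h]; last by apply: h; rewrite inE.
  by rewrite inE => /eqP ->.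
apply: le_trans (_ : mean (fun w : {ffun V * V -> A} =>
  \sum_(v : V) \sum_(z : V * V | z.1 != z.2) (w (v, z.1) == w (v, z.2))%:R) <= _).
  apply: mean_le => // w; case: existsP => [[v /injectivePn[x [y xy wxy]]]|_]; last first.
    by rewrite !sumr_ge0 // => *; rewrite sumr_ge0.
  rewrite (bigD1 v) //= (bigD1 (x, y)) //= [w _ == _](introT eqP wxy).
  rewrite -addrA lerDl addr_ge0 ?sumr_ge0 // => *; exact: sumr_ge0.
rewrite mean_sum (eq_bigr (fun v => \sum_(z : V * V | z.1 != z.2) #|A|%:R^-1)); last first.
  by move=> v _; rewrite mean_sum; apply: eq_bigr => z; exact: collide.
rewrite sumr_const sumr_const -[leLHS]mulr_natl -[X in _ * X]mulr_natl mulrA -natrM.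
rewrite ler_wpM2r ?invr_ge0 // ler_nat expnS leq_mul2l; apply/orP; right.
by apply: leq_trans (max_card _) _; rewrite card_prod.
Qed.

Lemma prodr_half (R : realFieldType) (T : finType) (J : {set T}) (b : pred T) :
  \prod_(j <- enum J) (1 - (b j)%:R / 2) = 2 ^- #|[set j in J | b j]| :> R.
Proof.
rewrite big_enum /= (bigID b) /= [X in _ * X]big1 ?mulr1; last first.
  by move=> j /andP[_ /negPf ->]; rewrite mul0r subr0.
rewrite (eq_bigr (fun=> 2^-1)); last first.
  by move=> j /andP[_ ->]; rewrite mulr1n; lra.
by rewrite prodr_const exprVn; congr (_ ^- _); apply: eq_card => j; rewrite !inE.
Qed.

Variables (r Q' : nat).
Notation Q := Q'.+1.
Notation V := ('I_r * 'I_Q)%type.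

Definition graph_set (a : {ffun 'I_r -> 'I_Q}) : {set V} := [set (i, a i) | i : 'I_r].
Definition shift (j : 'I_Q) (a : {ffun 'I_r -> 'I_Q}) : {ffun 'I_r -> 'I_Q} :=
  [ffun i => a i + j].

Lemma in_graph_set a z : (z \in graph_set a) = (a z.1 == z.2).
Proof.
case: z => x y; apply/imsetP/eqP => /= [[i _ [-> ->]] //|<-].
by exists x.
Qed.

Lemma card_graph_set a : #|graph_set a| = r.
Proof. by rewrite card_imset ?card_ord // => i j []. Qed.

Lemma graph_set_inj : injective graph_set.
Proof.
move=> a b ab; apply/ffunP => i; apply/esym/eqP.
have : (i, a i) \in graph_set a by rewrite in_graph_set.
by rewrite ab in_graph_set.
Qed.

Lemma shift_disjoint a i j : i != j ->
  [disjoint graph_set (shift i a) & graph_set (shift j a)].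
Proof.
move=> ij; rewrite -setI_eq0; apply/eqP/setP => z; rewrite !inE !in_graph_set !ffunE.
apply/negP => /andP[/eqP <- /eqP /addrI ji].
by rewrite ji eqxx in ij.
Qed.

(** A point [(i, y)] of [S] lies on exactly one translate of the graph of [a],
    namely the one by [y - a i]. *)
Lemma card_shift_disjoint a (S : {set V}) :
  (Q - #|S| <= #|[set j | [disjoint S & graph_set (shift j a)]]|)%N.
Proof.
rewrite leq_subLR -[X in (X <= _)%N]card_ord.
set J := [set j | _]; rewrite -cardsT -(setUCr J) addnC.
apply: leq_trans (leq_card_setU _ _) _; rewrite leq_add2l.
apply: leq_trans (leq_imset_card (fun z : V => z.2 - a z.1) (mem S)).
apply: subset_leq_card; apply/subsetP => j; rewrite !inE.
rewrite -setI_eq0 => /set0Pn[z]; rewrite !inE in_graph_set ffunE => /andP[zS /eqP zj].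
by apply/imsetP; exists z => //; rewrite -zj addrC addKr.
Qed.

(** Double counting: each function is hit once by every shift. *)
Lemma sum_shift (b : pred {ffun 'I_r -> 'I_Q}) :
  (\sum_a #|[set j | b (shift j a)]| = Q * #|[set a | b a]|)%N.
Proof.
under eq_bigr do rewrite -sum1dep_card big_mkcond /=.
rewrite exchange_big /=.
transitivity (\sum_(j < Q) #|[set a | b a]|)%N; last by rewrite sum_nat_const card_ord.
apply: eq_bigr => j _; rewrite -sum1dep_card [RHS]big_mkcond /=.
rewrite [RHS](reindex_inj (h := shift j)) //.
by move=> a a' /ffunP e; apply/ffunP => i; have := e i; rewrite !ffunE => /addIr.
Qed.

(** First moment method. Besides the event that some row is not injective, the
    quantity [Phi] below adds [2^(u - Y)] for every [S] and every class of
    translates; its mean is below [1], and where [Phi < 1] all rows are injective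
    and every [Y] exceeds [u]. Since at least [Q - (d + 1) = s * u] translates avoid
    [S], the choice of [s] beats the factor [2^u] by another [2^u], which pays for the
    polynomial number of terms. *)
Lemma exists_good_labelling (R : realFieldType) (A : finType) (a0 : A)
   (G : {set {set A}}) (d s u delta : nat) (p : R) :
  (forall e, e \in G -> #|e| = (d + r)%N) ->
  (forall B : {set A}, #|B| = d -> (delta <= #|[set e in G | B \subset e]|)%N) ->
  p = delta%:R / #|A|%:R ^+ r -> p <= 1 -> (1 - p ^+ (d + r).+1 / 2) ^+ s <= 4^-1 ->
  Q' = (s * u + d)%N ->
  (2 * (r * Q) ^ d.+1 * Q ^ r < 2 ^ u)%N ->
  (2 * (r * Q) ^ 3 <= #|A|)%N ->
  exists w : {ffun V * V -> A}, (forall v, injective (row w v)) /\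
    forall S : {set V}, #|S| = d.+1 -> forall a,
    (u < #|[set j | [disjoint S & graph_set (shift j a)] &&
        (S :|: graph_set (shift j a) \in random_edges G (d + r).+1 w)]|)%N.
Proof.
move=> Gk Gd pE p1 rho_s Q'E uQ mQ.
have cV : #|{: V}| = (r * Q)%N by rewrite card_prod !card_ord.
set rho := 1 - _ in rho_s.
have rho0 : 0 <= rho.
  have := @exprn_ile1 R (d + r).+1 p _ p1; rewrite pE divr_ge0 ?exprn_ge0 //.
  by move=> /(_ isT); rewrite -pE /rho; lra.
have rho1 : rho <= 1.
  by rewrite /rho lerBlDr lerDl divr_ge0 // exprn_ge0 // pE divr_ge0 ?exprn_ge0.
pose E (w : {ffun V * V -> A}) := random_edges G (d + r).+1 w.
pose J (S : {set V}) a := [set j | [disjoint S & graph_set (shift j a)]].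
pose s0 (S : {set V}) := [pick x in S].
pose term S a (w : {ffun V * V -> A}) : R :=
  if s0 S is Some x then (kept_injective d S x w)%:R * \prod_(j <- enum (J S a))
     (1 - (S :|: graph_set (shift j a) \in E w)%:R / 2) else 0.
have term_le (S : {set V}) a : #|S| = d.+1 -> mean (term S a) <= 4 ^- u.
  move=> cS; rewrite /term /s0; case: pickP => [x xS|]; last first.
    by rewrite mean_cst // invr_ge0 exprn_ge0.
  apply: le_trans (_ : rho ^+ #|J S a| <= _).
    rewrite cardE /rho pE; apply: mean_missing_edges => //; rewrite -?pE ?enum_uniq //.
    - by move=> j _; rewrite card_graph_set.
    - by move=> j; rewrite mem_enum inE.
    - by move=> i j _ _; exact: shift_disjoint.
  apply: le_trans (_ : rho ^+ (s * u) <= _).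
    apply: ler_wiXn2l => //; apply: leq_trans (card_shift_disjoint a S).
    by rewrite cS Q'E subSS addnK.
  by rewrite exprM -exprVn lerXn2r ?nnegrE ?exprn_ge0 ?invr_ge0.
have term0 (S : {set V}) a w : 0 <= term S a w.
  rewrite /term; case: (s0 S) => // x; rewrite mulr_ge0 // big_seq prodr_ge0 // => j _.
  by case: (_ \in _); rewrite ?mulr1n ?mulr0n; lra.
pose Phi (w : {ffun V * V -> A}) : R := [exists v, ~~ injectiveb (row w v)]%:R +
   \sum_(S : {set V} | #|S| == d.+1) \sum_a 2 ^+ u * term S a w.
have sum0 w : 0 <= \sum_(S : {set V} | #|S| == d.+1) \sum_a 2 ^+ u * term S a w.
  by do 2!apply: sumr_ge0 => ? _; rewrite mulr_ge0 ?exprn_ge0.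
have [w Phiw] : exists w, Phi w < 1.
  apply: mean_lt_ex => //; rewrite /Phi meanD.
  have h1 := @mean_not_injective R A V a0.
  have h2 : (#|{: V}| ^ 3)%:R / #|A|%:R <= 2^-1 :> R.
    have A0 : 0 < #|A|%:R :> R by rewrite ltr0n; apply/card_gt0P; exists a0.
    by rewrite ler_pdivrMr // ler_pdivlMl // -natrM ler_nat cV.
  have h3 : mean (fun w => \sum_(S : {set V} | #|S| == d.+1) \sum_a 2 ^+ u * term S a w)
      <= ((r * Q) ^ d.+1 * Q ^ r)%:R * 2 ^- u.
    rewrite mean_sum.
    apply: le_trans (_ : \sum_(S : {set V} | #|S| == d.+1)
        \sum_(a : {ffun 'I_r -> 'I_Q}) (2 ^- u : R) <= _).
      apply: ler_sum => S /eqP cS; rewrite mean_sum; apply: ler_sum => a _.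
      rewrite meanZ; apply: le_trans (_ : 2 ^+ u * 4 ^- u <= _).
        by rewrite ler_wpM2l ?exprn_ge0 // term_le.
      have -> : 4 = 2 * 2 :> R by lra.
      by rewrite exprMn invfM mulrA divff ?mul1r // expf_neq0.
    rewrite sumr_const sumr_const card_ffun !card_ord.
    rewrite -[leLHS]mulr_natl -[X in _ * X]mulr_natl mulrA -natrM.
    rewrite ler_wpM2r ?invr_ge0 ?exprn_ge0 // ler_nat leq_mul2r; apply/orP; right.
    rewrite -[X in (X <= _)%N]cardsE card_draws cV.
    exact: leq_bin_expn.
  have h4 : ((r * Q) ^ d.+1 * Q ^ r)%:R * 2 ^- u < 2^-1 :> R.
    rewrite ltr_pdivrMr ?exprn_gt0 // ltr_pdivlMl //.
    by rewrite -natrX -natrM ltr_nat mulnA.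
  by lra.
have winj v : injective (row w v).
  apply/injectiveP; apply: contraTT Phiw => nv; rewrite -leNgt /Phi.
  have -> : [exists v, ~~ injectiveb (row w v)] by apply/existsP; exists v.
  by rewrite lerDl.
exists w; split=> // S cS a.
have : 2 ^+ u * term S a w < 1.
  apply: le_lt_trans Phiw; rewrite /Phi (bigD1 S) ?cS //= (bigD1 a) //=.
  rewrite addrCA -!addrA lerDl addr_ge0 ?addr_ge0 //.
    by apply: sumr_ge0 => *; rewrite mulr_ge0 ?exprn_ge0.
  by do 2!apply: sumr_ge0 => ? _; rewrite mulr_ge0 ?exprn_ge0.
rewrite /term /s0; case: pickP => [x xS|S0]; last first.
  by move: cS; rewrite (eq_card0 S0).
have -> : kept_injective d S x w.
  by apply/forallP => v; rewrite card_imset // (card_kept cS xS).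
rewrite mul1r (prodr_half _ _ (fun j => S :|: graph_set (shift j a) \in E w)).
rewrite ltr_pdivrMr ?exprn_gt0 // mul1r ltr_eXn2l ?ltr1n //.
by move=> /leq_trans; apply; apply: subset_leq_card; apply/subsetP => j; rewrite !inE.
Qed.

(** Every class of [Q] translates contains more than [u] edges over [S], where [u]
    is at least the fraction [1 / K] of [Q]. Averaging over the classes, at least the
    fraction [1 / K] of the [Q^r] graphs completes [S] to an edge. *)
Lemma exists_dense_suspension_free (R : realFieldType) (F : hypergraph) (A : finType) (a0 : A)
   (G : {set {set A}}) (d s u delta K : nat) (p : R) :
  kgraph (d + r) (Hypergraph G) -> ~~ has_copy F (Hypergraph G) ->
  (forall B : {set A}, #|B| = d -> (delta <= #|[set e in G | B \subset e]|)%N) ->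
  p = delta%:R / #|A|%:R ^+ r -> p <= 1 -> (1 - p ^+ (d + r).+1 / 2) ^+ s <= 4^-1 ->
  Q' = (s * u + d)%N -> (Q <= K * u)%N -> (d < r * Q)%N ->
  (2 * (r * Q) ^ d.+1 * Q ^ r < 2 ^ u)%N ->
  (2 * (r * Q) ^ 3 <= #|A|)%N ->
  ('C(r * Q - d.+1, r) <= r ^ r * K * ex_deg (d + r).+1 d.+1 (r * Q) (suspension F))%N.
Proof.
move=> Gk GF Gd pE p1 rho_s Q'E QK dV uQ mQ.
have Gk' e : e \in G -> #|e| = (d + r)%N by move/forall_inP: Gk => /(_ e) + eG => /(_ eG)/eqP.
have [w [winj wS]] := exists_good_labelling a0 Gk' Gd pE p1 rho_s Q'E uQ mQ.
pose H := Hypergraph (random_edges G (d + r).+1 w).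
have cV : #|{: V}| = (r * Q)%N by rewrite card_prod !card_ord.
apply: leq_trans (_ : r ^ r * K * min_degree d.+1 H <= _)%N; last first.
  rewrite leq_mul2l; apply/orP; right.
  apply: (@leq_ex_deg _ _ _ _ _ H) => //; first exact: random_edges_kgraph.
  exact: random_edges_suspension_free.
have QrS (S : {set V}) : #|S| = d.+1 -> (Q ^ r <= K * @degree H S)%N.
  move=> cS; pose good a := [disjoint S & graph_set a] && (S :|: graph_set a \in edges H).
  apply: leq_trans (_ : K * #|[set a | good a]| <= _)%N; last first.
    rewrite leq_mul2l; apply/orP; right.
    rewrite -(@card_in_imset _ _ (fun a => S :|: graph_set a)); last first.
      move=> a b; rewrite !inE => /andP[aS _] /andP[bS _].
      move=> /(congr1 (fun B => B :\: S)); rewrite !setDUl setDv !set0U.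
      move: aS bS; rewrite ![[disjoint S & _]]disjoint_sym.
      by move=> /setDidPl -> /setDidPl -> /graph_set_inj.
    apply: subset_leq_card; apply/subsetP => _ /imsetP[a + ->].
    rewrite inE => /andP[_ aH]; rewrite inE; apply/andP; split; first exact: aH.
    exact: subsetUl.
  rewrite -(@leq_pmul2l Q) // mulnCA -sum_shift.
  apply: leq_trans (_ : K * u * Q ^ r <= _)%N; first by rewrite leq_mul2r QK orbT.
  rewrite -mulnA leq_mul2l; apply/orP; right.
  have -> : (u * Q ^ r = \sum_(a : {ffun 'I_r -> 'I_Q}) u)%N.
    by rewrite sum_nat_const card_ffun !card_ord mulnC.
  by apply: leq_sum => a _; exact/ltnW/wS.
apply: leq_trans (_ : r ^ r * Q ^ r <= _)%N.
  rewrite -expnMn; apply: leq_trans (_ : (r * Q - d.+1) ^ r <= _)%N.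
    exact: leq_bin_expn.
  by case: r => // r'; rewrite leq_exp2r // leq_subr.
rewrite -mulnA leq_mul2l leqNgt; apply/orP; right; apply/negP => lt_Q.
have dH : (d < #|vertex H|)%N by rewrite cV.
suff : (min_degree d.+1 H < min_degree d.+1 H)%N by rewrite ltnn.
apply/(min_degree_leP _ dH) => S /QrS le_Q.
have := leq_trans lt_Q le_Q; rewrite ltn_mul2l => /andP[_].
exact.
Qed.
End DenseSuspensionFree.

(** * Asymptotics *)

Section Asymptotics.
Import numFieldNormedType.Exports.
Local Open Scope ring_scope.

(** Both [A] and [k] are fixed, so for [u = 2^(2 * y)] with [y] large the claim
    reduces to an exponent linear in [y] being less than [2^(2 * y)]. *)
Lemma expn_dominates (A k N : nat) : exists2 u, (N <= u)%N & (2 * (A * u) ^ k < 2 ^ u)%N.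
Proof.
pose y := (A + 4 * k + N + 2)%N; have y2 : (y < 2 ^ y)%N by rewrite ltn_expl.
exists (2 ^ (2 * y))%N.
  by apply: leq_trans (ltnW (ltn_expl _ (ltnSn 1))); rewrite /y; lia.
apply: leq_ltn_trans (_ : 2 * 2 ^ ((A + 2 * y) * k) < _)%N.
  rewrite leq_mul2l (expnM 2 (A + 2 * y)); apply/orP; right.
  have [->|k0] := posnP k; first by rewrite !expn0.
  by rewrite leq_exp2r // expnD leq_mul2r (ltnW (ltn_expl _ _)) ?orbT.
rewrite -expnS ltn_exp2l //; apply: (@ltn_trans (y * y)); first by rewrite /y; nia.
by rewrite mul2n -addnn expnD ltn_mul.
Qed.

Lemma bin_lower_bound (m d r : nat) : (2 * (d + r) <= m)%N ->
  (m ^ r <= 2 ^ r * r`! * 'C(m - d, r))%N.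
Proof.
move=> dm; rewrite -mulnA [(r`! * _)%N]mulnC bin_ffact.
have : (m <= 2 * (m - d - r))%N by lia.
move=> m2; apply: leq_trans (_ : (2 * (m - d - r)) ^ r <= _)%N.
  by case: r {dm} m2 => // r m2; rewrite leq_exp2r.
rewrite expnMn leq_mul2l; apply/orP; right.
move: (m - d)%N => x {m2 dm}; elim: r x => // r IH x.
rewrite ffactnSr expnSr leq_mul //; last by rewrite leq_sub2l.
apply: leq_trans (IH x); case: r {IH} => // r; rewrite leq_exp2r //; lia.
Qed.

Lemma exists_expr_le_quarter (R : realType) (x : R) : 0 <= x < 1 -> exists s, x ^+ s <= 4^-1.
Proof.
move=> /andP[x0 x1].
have /cvgrPdist_lt : ((fun n => x ^+ n) @ \oo --> (0 : R))%classic.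
  by apply: cvg_expr; rewrite ger0_norm.
move=> /(_ 4^-1) []; first by rewrite invr_gt0.
move=> s _ /(_ s (leqnn s)); rewrite sub0r normrN ger0_norm ?exprn_ge0 // => xs.
by exists s; exact: ltW.
Qed.

(** The constant [c = p0^k] of the random construction depends only on [eps], [d]
    and [r], and so do [s] and [K]. Only then are [u] and, last, the number [m] of
    vertices of [G] chosen large. *)
Lemma dense_suspension_free_graphs (R : realType) (F : hypergraph) (d r : nat) (eps : R) :
  (0 < r)%N -> 0 < eps ->
  (forall N, exists2 m, (N <= m)%N &
     eps * ('C(m - d, r))%:R <= (ex_deg (d + r) d m F)%:R) ->
  exists2 eta : R, 0 < eta & forall N, exists2 n, (N <= n)%N &
     eta * ('C(n - d.+1, r))%:R <= (ex_deg (d + r).+1 d.+1 n (suspension F))%:R.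
Proof.
move=> r0 eps0 big.
pose B := (2 ^ r * r`!)%N.
have B0 : 0 < B%:R :> R by rewrite ltr0n muln_gt0 expn_gt0 fact_gt0.
pose p0 : R := Num.min (eps / B%:R) 1.
have p00 : 0 < p0 by rewrite lt_min ltr01 divr_gt0.
have p01 : p0 <= 1 by rewrite ge_min lexx orbT.
pose x : R := 1 - p0 ^+ (d + r).+1 / 2.
have [s xs] : exists s, x ^+ s <= 4^-1.
  apply: exists_expr_le_quarter; have := exprn_gt0 (d + r).+1 p00.
  have := exprn_ile1 (d + r).+1 (ltW p00) p01; rewrite /x; move: (_ ^+ _) => z ? ?.
  by apply/andP; split; lra.
have s0 : (0 < s)%N.
  by case: s xs => //; rewrite expr0; lra.
pose K := (s + d).+1.
have rK : (0 < r ^ r * K)%N by rewrite muln_gt0 expn_gt0 r0.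
exists (r ^ r * K)%:R^-1 => [|N]; first by rewrite invr_gt0 ltr0n.
have [u uN uQ] := expn_dominates (r * K) (d + r).+1 N.+1.
pose Q' := (s * u + d)%N.
have QK : (Q'.+1 <= K * u)%N by rewrite /Q' /K; nia.
exists (r * Q'.+1)%N; first by rewrite /Q'; nia.
have [m mN epsm] := big (2 * (r * Q'.+1) ^ 3 + 2 * (d + r))%N.
have dm : (2 * (d + r) <= m)%N by apply: leq_trans mN; exact: leq_addl.
have C0 : (0 < 'C(m - d, r))%N by rewrite bin_gt0; lia.
have ex0 : (0 < ex_deg (d + r) d m F)%N.
  by rewrite -(ltr0n R); apply: lt_le_trans epsm; rewrite mulr_gt0 ?ltr0n.
have [G [Gk GF Gex]] := ex_deg_gt ex0.
have dmG : (d <= #|vertex (Hypergraph G)|)%N by rewrite card_ord; lia.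
have Gd := elimT (min_degree_leP _ dmG) (leqnn _).
rewrite Gex in Gd.
(* Truncating at [m ^ r] only serves to make [p <= 1] evident. *)
pose delta := minn (ex_deg (d + r) d m F) (m ^ r).
have m0 : (0 < m)%N by lia.
pose p : R := delta%:R / m%:R ^+ r.
have mr0 : 0 < m%:R ^+ r :> R by rewrite exprn_gt0 ?ltr0n.
have p1 : p <= 1.
  by rewrite ler_pdivrMr // mul1r -natrX ler_nat geq_minr.
have p0p : p0 <= p.
  rewrite /p ler_pdivlMr // natr_min le_min; apply/andP; split; last first.
    by rewrite natrX ler_piMl // ltW.
  apply: le_trans epsm; apply: le_trans (_ : eps / B%:R * m%:R ^+ r <= _).
    by apply: ler_wpM2r; [exact: ltW | rewrite ge_min lexx].
  rewrite -mulrA ler_pM2l // ler_pdivrMl // -natrX -natrM ler_nat.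
  exact: bin_lower_bound.
have [rho_s uQ' mQ] : [/\ (1 - p ^+ (d + r).+1 / 2) ^+ s <= 4^-1,
    (2 * (r * Q'.+1) ^ d.+1 * Q'.+1 ^ r < 2 ^ u)%N & (2 * (r * Q'.+1) ^ 3 <= m)%N].
  split; last by apply: leq_trans mN; exact: leq_addr.
    apply: le_trans xs; rewrite /x lerXn2r ?nnegrE //.
    - by have := exprn_ile1 (d + r).+1 (le_trans (ltW p00) p0p) p1; lra.
    - by have := exprn_ile1 (d + r).+1 (ltW p00) p01; lra.
    - have : p0 ^+ (d + r).+1 <= p ^+ (d + r).+1.
        by rewrite lerXn2r ?nnegrE ?(ltW p00) // (le_trans (ltW p00)).
      lra.
  apply: leq_ltn_trans uQ; rewrite -mulnA leq_mul2l /= -addSn expnD.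
  have rQ : (r * Q'.+1 <= r * K * u)%N by rewrite -mulnA leq_mul2l QK orbT.
  apply: leq_mul; first by rewrite leq_exp2r.
  rewrite leq_exp2r //; apply: leq_trans rQ; exact: leq_pmull.
have := exists_dense_suspension_free (R := R) (Ordinal m0) Gk GF _ _ p1 rho_s erefl QK _ uQ'.
move=> /(_ delta) dense.
rewrite ler_pdivrMl ?ltr0n // -natrM ler_nat; apply: dense.
- by move=> S cS; apply: leq_trans (geq_minl _ _) (Gd S cS).
- by rewrite card_ord.
- by rewrite /Q'; nia.
- by rewrite card_ord.
Qed.

End Asymptotics.

Theorem theorem1p7 (R : realType) (k l : nat) (hl : (2 <= l)%N) (hlk : (l < k)%N)
    (F : hypergraph) (hF : kgraph (k - 1) F) :
  is_degree_turan_density k l (suspension F) (0%R : R) <->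
  is_degree_turan_density (k - 1) (l - 1) F (0%R : R).
Proof.
have ratio_ge0 (a b : nat) : (0 <= a%:R / b%:R :> R)%R by rewrite divr_ge0.
pose d := l.-1; pose r := (k - l)%N.
have lE : l = d.+1 by rewrite prednK //; lia.
have kE : k = (d + r).+1 by rewrite /d /r; lia.
have r0 : (0 < r)%N by rewrite subn_gt0.
rewrite /is_degree_turan_density kE lE !subn1 subSS /= !addKn.
split=> /cvgrPdist_lt lim0; apply/cvgrPdist_lt => eps eps0; last first.
  have [N _ limN] := lim0 _ eps0.
  exists (N + d).+1 => // -[//|n] /= nN.
  have /= := limN n; rewrite !sub0r !normrN !ger0_norm //.
  move=> /(_ ltac:(lia)); apply: le_lt_trans.
  rewrite subSS ler_wpM2r ?invr_ge0 // ler_nat.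
  by have := @ex_deg_suspension (d + r).+1 d.+1 n.+1 F; apply; lia.
apply: contrapT => notlim.
have [N|eta eta0 etaP] := @dense_suspension_free_graphs R F d r eps r0 eps0.
  apply: contrapT => small; apply: notlim; exists N => // m /= Nm.
  rewrite sub0r normrN ger0_norm // ltNge; apply/negP => epsm.
  apply: small; exists m => //.
  have [->|C0] := posnP 'C(m - d, r); first by rewrite mulr0.
  by rewrite -ler_pdivlMr // ltr0n.
have [N _ limN] := lim0 _ eta0.
have [n nN] := etaP (N + (d + r).+1)%N.
have := limN n; rewrite /= sub0r normrN ger0_norm // => /(_ ltac:(lia)).
have C0 : (0 < 'C(n - d.+1, r))%N by rewrite bin_gt0; lia.
by rewrite ltNge -ler_pdivlMr ?ltr0n // => /negP.
Qed.
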